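(* Let $p^{(1)}\,\dot\cup\,p^{(2)}=\mathbb N$ be a partition of $\mathbb N=\{1,2,\dots\}$ into two disjoint sets, with $p^{(1)}$ finite of size $r$, and let $p^{(u)}_i$ denote the $i$-th smallest element of $p^{(u)}$. If $(\gamma,\theta)\in\mathcal D^\infty_{\ge0}\times\mathcal D^\infty_{\ge0}$ is feasible for $m\in\mathbb N$, then $$\sum_{i\in P^{(1)}_m}\gamma_i^2\le\sum_{i\in\mathbb N\setminus P^{(2)}_m}\theta_i^2,\qquad P^{(u)}_m:=\{m(p^{(u)}_i-i)+i\mid i=1,2,\dots\},\quad u=1,2,$$ where $i$ ranges over $1,\dots,r$ for $u=1$ and over all of $\mathbb N$ for $u=2$.
   Context: $\mathcal D^\infty_{\ge0}$ is the set of weakly decreasing sequences of non-negative reals with finitely many nonzero entries; $\deg(v)$ is the number of positive entries of $v$. $\mathbb K\in\{\mathbb R,\mathbb C\}$. A pair $(\gamma,\theta)$ is feasible for $m$ if there is a tensor $A\in\mathbb K^{\deg(\gamma)\times m\times\deg(\theta)}$ whose matricizations $A^{(\{1\})}\in\mathbb K^{\deg(\gamma)\times m\deg(\theta)}$ (rows indexed by $i_1$, columns by $(i_2,i_3)$) and $A^{(\{1,2\})}\in\mathbb K^{\deg(\gamma)m\times\deg(\theta)}$ (rows indexed by $(i_1,i_2)$, columns by $i_3$) have singular values (sorted weakly decreasingly, extended by zeros) $\gamma$ and $\theta$, respectively (a tensor with a mode of size $0$ is understood to have only zero singular values). *)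

(* Defs.v *)
From HB Require Import structures.
From mathcomp Require Import all_boot all_order all_algebra.
From mathcomp Require Import finmap sesquilinear.
From mathcomp Require Import all_classical all_reals.
From mathcomp Require Import sequences.
From mathcomp Require Import complex.

Set Implicit Arguments.
Unset Strict Implicit.
Unset Printing Implicit Defensive.

Import Order.TTheory GRing.Theory Num.Theory.
Local Open Scope classical_set_scope.
Local Open Scope ring_scope.
Local Open Scope sesquilinear_scope.

(* Indices start at 0: the value at [i : nat] of a sequence is the entry that
   is written with the index i + 1 when counting from 1, and the natural
   number i stands for the element i + 1 of {1, 2, ...}. *)

Definition Dinfty (R : realType) : set (nat -> R) :=
  [set v : nat -> R | [/\ nonincreasing_seq v,
                          forall i, 0 <= v i
                        & finite_set [set i | v i != 0]]].
Arguments Dinfty : clear implicits.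

Definition deg (R : realType) (v : nat -> R) : nat :=
  #|` fset_set [set i | 0 < v i]|%fset.

(* [F] is R or C, [inj] the embedding of R into [F] and [conj] the conjugation
   of [F]; see [feasible] for the two instances. *)
Section ScalarField.
Variables (R : realType) (F : fieldType) (inj : R -> F) (conj : F -> F).

Definition unitary n (U : 'M[F]_n) : Prop := U *m U ^t conj = 1%:M.

Definition diag_rect p q (s : nat -> R) : 'M[F]_(p, q) :=
  \matrix_(i < p, j < q) (inj (s i) *+ (i == j :> nat)).

Definition has_singular_values p q (M : 'M[F]_(p, q)) (s : nat -> R) : Prop :=
  [/\ nonincreasing_seq s,
      forall i, 0 <= s i,
      forall i, (minn p q <= i)%N -> s i = 0
    & exists U V, [/\ unitary U, unitary V
                    & M = U *m diag_rect p q s *m V ^t conj]].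

(* The columns of [mat1 A] are indexed by the pairs (j, k) and the rows of
   [mat12 A] by the pairs (i, j), in both cases listed block by block in j;
   the order of the listing does not affect the singular values. *)
Definition mat1 n1 m n2 (A : 'I_n1 -> 'I_m -> 'I_n2 -> F) :
    'M[F]_(n1, \sum_(j < m) n2) :=
  \mxrow_(j < m) \matrix_(i < n1, k < n2) A i j k.

Definition mat12 n1 m n2 (A : 'I_n1 -> 'I_m -> 'I_n2 -> F) :
    'M[F]_(\sum_(j < m) n1, n2) :=
  \mxcol_(j < m) \matrix_(i < n1, k < n2) A i j k.

Definition feasible_over (m : nat) (gamma theta : nat -> R) : Prop :=
  exists A : 'I_(deg gamma) -> 'I_m -> 'I_(deg theta) -> F,
    has_singular_values (mat1 A) gamma /\ has_singular_values (mat12 A) theta.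

End ScalarField.

Variant scalars := RealScalars | ComplexScalars.

Definition feasible (R : realType) (K : scalars) (m : nat)
    (gamma theta : nat -> R) : Prop :=
  match K with
  | RealScalars => feasible_over (F := R) id id m gamma theta
  | ComplexScalars =>
      feasible_over (F := R[i]) (real_complex R) (@conjc R) m gamma theta
  end.

(* [a] is the element of [p] with exactly [i] elements of [p] below it. *)
Definition is_nth_smallest (p : set nat) (i a : nat) : Prop :=
  p a /\ ([set b | p b /\ (b < a)%N] #= `I_i)%card.

(* The formula m (p_i - i) + i is unchanged by counting from 0: shifting p_i, i
   and the result by 1 preserves it.  As i <= a, the subtraction does not
   truncate. *)
Definition Pset (m : nat) (p : set nat) : set nat :=
  [set x | exists i a, is_nth_smallest p i a /\ x = (m * (a - i) + i)%N].

(* Main.v *)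
Require Import Defs.
From mathcomp Require Import all_boot all_order all_algebra.
From mathcomp Require Import all_classical all_reals.
From mathcomp Require Import perm sesquilinear spectral.
From mathcomp Require Import sequences complex.
From mathcomp Require Import zify ring lra.

Set Implicit Arguments.
Unset Strict Implicit.
Unset Printing Implicit Defensive.
Import Order.TTheory GRing.Theory Num.Theory.
Local Open Scope classical_set_scope.
Local Open Scope ring_scope.

(** Write [A_j], for [j] below [m], for the slices of the tensor and [X^H] for
    an adjoint.  Up to zeros, the squares of [gamma] are the eigenvalues of the
    sum of the [A_j A_j^H], those of [theta] the eigenvalues of the sum of the
    [A_j^H A_j], and for each [j] the two summands have the same eigenvalues
    [mu_j 0 >= mu_j 1 >= ...].  Both sums of Gram matrices satisfy the
    Thompson-Freede inequalities for [m] summands: for [a 0 < ... < a (r-1)],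

       sum_k lam (m (a k - k) + k) <= sum_j sum_k mu_j (a k),

    where [lam] is the decreasing spectrum of the sum.  Let [nu k] be the sum
    over [j] of the [mu_j k].

    For the first sum and the elements [a k] of [p1] this gives
    [ sum over Pset m p1 of gamma^2 <= sum over p1 of nu ].  For the second sum
    and the elements of [p2] below a large [N] it gives
    [ sum over part of Pset m p2 of theta^2 <= sum over p2 below N of nu ].
    As the second sum of Gram matrices has trace equal both to the sum of all
    [theta^2] and to the sum of all [nu], passing to complements turns the
    latter inequality into
    [ sum over p1 of nu <= sum over the complement of Pset m p2 of theta^2 ]:
    for the right truncation, the discarded part of [Pset m p2] consists of
    all numbers from some [n] on, and nonnegativity of [nu] takes care of the
    indices between [N] and [n].

    The Thompson-Freede inequalities are proved in [sum_eigen_le_of_flags] by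
    the variational argument of Hersch and Zwahlen: one subspace [W] of
    dimension [r] is found that meets the flag of top eigenspaces of the sum
    and the flags of bottom eigenspaces of all summands in the right dimensions
    ([exists_common_subspace]), and the trace of the compression to [W] is
    estimated in bases adapted to the flags ([exists_adapted_basis]).  That the
    same [mu_j] serves for [A_j A_j^H] and [A_j^H A_j] is
    [dotmx_bottom_flag_adj]. *)

(** * Subspaces in prescribed position with respect to flags *)

Section Subspaces.
Variables (F : fieldType) (n : nat).

Lemma mxrank_adds_row p (W : 'M[F]_(p, n)) (v : 'rV_n) :
  ~~ (v <= W)%MS -> \rank (W + v)%MS = (\rank W).+1.
Proof.
move=> vW; apply/eqP; rewrite eqn_leq; apply/andP; split.
  apply: leq_trans (mxrank_adds_leqif W v) _.
  by rewrite -[X in (_ <= X)%N]addn1 leq_add2l rank_leq_row.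
rewrite rank_ltmx // ltmxE addsmxSl /=.
by apply: contra vW; apply: submx_trans; apply: addsmxSr.
Qed.

Lemma mxrank_cap_geq p q (A : 'M[F]_(p, n)) (B : 'M_(q, n)) :
  (\rank A + \rank B <= \rank (A :&: B)%MS + n)%N.
Proof. by rewrite -mxrank_sum_cap addnC leq_add2l rank_leq_col. Qed.

Lemma mxrank_bigcap_geq m (C : 'I_m -> 'M[F]_n) c :
  (forall j, n <= \rank (C j) + c)%N ->
  (n <= \rank (\bigcap_j C j)%MS + m * c)%N.
Proof.
elim: m C => [|m IH] C hC; first by rewrite big_ord0 mxrank1 leq_addr.
rewrite big_ord_recr /=.
have := mxrank_cap_geq (\bigcap_(i < m) C (widen_ord (leqnSn m) i))%MS (C ord_max).
have := IH (fun i => C (widen_ord (leqnSn m) i)) (fun j => hC _).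
have := hC ord_max; rewrite mulSn /=; lia.
Qed.

Lemma exists_mxrank_between (D C : 'M[F]_n) t :
  (D <= C)%MS -> (\rank D <= t <= \rank C)%N ->
  exists E : 'M_n, [/\ (D <= E)%MS, (E <= C)%MS & \rank E = t].
Proof.
elim: t => [|t IH] DC /andP[Dt tC].
  by exists D; split => //; apply/eqP; rewrite -leqn0.
move: Dt; rewrite leq_eqVlt => /predU1P[<-|]; first by exists D.
rewrite ltnS => Dt.
have [|E [DE EC rE]] := IH DC; first by rewrite Dt ltnW.
have : ~~ (C <= E)%MS by apply: contraL tC => /mxrankS; lia.
case/row_subPn=> i hi.
exists (E + row i C)%MS; split.
- exact: submx_trans DE (addsmxSl _ _).
- by rewrite addsmx_sub EC row_sub.
- by rewrite mxrank_adds_row ?rE.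
Qed.

(** A Schubert-type intersection statement: if the codimensions of the
    descending flags add up to no more than the dimensions of the ascending
    flag leave free, a single subspace [W] meets all the flags in the expected
    dimensions.  [W] is spanned by vectors chosen one after the other, the
    [k]-th one from [M k]; for [W] to meet [S j k] in dimension [r - k] it is
    enough that [W + S j k] exceeds [S j k] by at most [k] dimensions. *)
Lemma exists_common_subspace m r (a : nat -> nat) (M : nat -> 'M[F]_n)
    (S : 'I_m -> nat -> 'M[F]_n) :
  (forall k, (k.+1 < r)%N -> (a k < a k.+1)%N) ->
  (forall k, (k < r)%N -> (m * (a k - k) + k < \rank (M k))%N) ->
  (forall k, (k.+1 < r)%N -> (M k <= M k.+1)%MS) ->
  (forall j k, (k < r)%N -> (n <= \rank (S j k) + a k)%N) ->
  (forall j k, (k.+1 < r)%N -> (S j k.+1 <= S j k)%MS) ->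
  exists W : 'M[F]_n, [/\ \rank W = r,
    forall k, (k < r)%N -> (k < \rank (W :&: M k)%MS)%N &
    forall j k, (k < r)%N -> (r - k <= \rank (W :&: S j k)%MS)%N].
Proof.
move=> ha rM MS rS SS.
have hak k : (k < r)%N -> (k <= a k)%N.
  by elim: k => // k IH kr; apply: leq_ltn_trans (IH (ltnW kr)) (ha k kr).
(* [C j] is the room left for later vectors: everything chosen so far and the
   next subspace [S j s] lie in it, and it exceeds each [S j k] by at most [k]
   dimensions.  Its codimension is small enough for [M s] to meet all the rooms
   outside [W]. *)
pose room s (W : 'M[F]_n) (C : 'I_m -> 'M[F]_n) := forall j,
  [/\ (W <= C j)%MS, (S j s <= C j)%MS, (n <= \rank (C j) + (a s - s))%N &
    forall k, (k <= s)%N -> (\rank (C j + S j k)%MS <= \rank (S j k) + k)%N].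
have pick s W C : (s < r)%N -> \rank W = s -> room s W C ->
    exists e : 'rV_n,
      [/\ (e <= M s)%MS, forall j, (e <= C j)%MS & ~~ (e <= W)%MS].
  move=> sr rW hC.
  have h1 : (n <= \rank (\bigcap_j C j)%MS + m * (a s - s))%N.
    by apply: mxrank_bigcap_geq => j; case: (hC j).
  have h2 := mxrank_cap_geq (M s) (\bigcap_j C j)%MS.
  have h3 := rM s sr.
  have : ~~ ((M s :&: \bigcap_j C j)%MS <= W)%MS.
    by apply/negP => /mxrankS; rewrite rW; lia.
  case/row_subPn=> i hi; exists (row i (M s :&: \bigcap_j C j)%MS); split => //.
    exact: submx_trans (row_sub _ _) (capmxSl _ _).
  move=> j; apply: submx_trans (row_sub _ _) _.
  by apply: submx_trans (capmxSr _ _) _; apply: bigcapmx_inf (submx_refl _).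
have step s : (s < r)%N -> exists W C, [/\ \rank W = s, (W <= M s)%MS,
    forall k, (k < s)%N -> (k < \rank (W :&: M k)%MS)%N & room s W C].
  elim: s => [|s IH] sr.
    exists 0, (fun j => S j 0%N); split; rewrite ?mxrank0 ?sub0mx // => j.
    split; rewrite ?sub0mx ?submx_refl //; first by rewrite subn0 rS.
    by move=> k; rewrite leqn0 => /eqP ->; rewrite (addsmx_idPl (submx_refl _)) addn0.
  have [W [C [rW WM hW hC]]] := IH (ltnW sr).
  have [e [eM eC eW]] := pick _ _ _ (ltnW sr) rW hC.
  have rW' : \rank (W + e)%MS = s.+1 by rewrite mxrank_adds_row ?rW.
  have W'M : (W + e <= M s)%MS by rewrite addsmx_sub WM eM.
  (* The room is shrunk to codimension [a s.+1 - s.+1] when possible, and kept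
     at the smallest admissible space when that is already larger. *)
  have hE j : exists E : 'M_n, [/\ (W + e + S j s.+1 <= E)%MS, (E <= C j)%MS &
      \rank E = maxn (\rank (W + e + S j s.+1)%MS) (n - (a s.+1 - s.+1))].
    have [WC SC rC _] := hC j.
    apply: exists_mxrank_between.
      by rewrite !addsmx_sub WC eC (submx_trans (SS _ _ sr)).
    rewrite leq_maxl /= geq_max; apply/andP; split.
      by apply: mxrankS; rewrite !addsmx_sub WC eC (submx_trans (SS _ _ sr)).
    have := ha s sr; have := hak s (ltnW sr); lia.
  have [C' hC'] : exists C' : 'I_m -> 'M_n, forall j,
      [/\ (W + e + S j s.+1 <= C' j)%MS, (C' j <= C j)%MS &
      \rank (C' j) = maxn (\rank (W + e + S j s.+1)%MS) (n - (a s.+1 - s.+1))].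
    have [f hf] := fin_all_exists hE; by exists f.
  exists (W + e)%MS, C'; split => //.
  - exact: submx_trans W'M (MS _ sr).
  - move=> k; rewrite ltnS leq_eqVlt => /predU1P[->|ks].
      by rewrite (capmx_idPl W'M) rW'.
    apply: leq_trans (hW k ks) _; apply: mxrankS.
    by apply: capmxS => //; apply: addsmxSl.
  - move=> j; have [WC' C'C rC'] := hC' j; have [WC SC rC hCk] := hC j.
    move: (WC'); rewrite addsmx_sub => /andP[W'C' SC'].
    split => //; first by rewrite rC' addnC -leq_subLR leq_maxr.
    move=> k; rewrite leq_eqVlt => /predU1P[->|].
      rewrite (addsmx_idPl SC') rC' geq_max; apply/andP; split.
        by apply: leq_trans (mxrank_adds_leqif _ _) _; rewrite rW' addnC.
      by move: (rS j _ sr) (hak _ sr); clear; lia.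
    rewrite ltnS => ks; apply: leq_trans (hCk k ks).
    by apply: mxrankS; apply: addsmxS.
case: r ha rM MS rS SS hak pick step => [|r] ha rM MS rS SS hak pick step.
  by exists 0; split => //; rewrite mxrank0.
have [W [C [rW WM hW hC]]] := step r (ltnSn r).
have [e [eM eC eW]] := pick _ _ _ (ltnSn r) rW hC.
have rW' : \rank (W + e)%MS = r.+1 by rewrite mxrank_adds_row ?rW.
have W'M : (W + e <= M r)%MS by rewrite addsmx_sub WM eM.
exists (W + e)%MS; split => // [k|j k]; rewrite ltnS => kr.
  move: kr; rewrite leq_eqVlt => /predU1P[->|ks].
    by rewrite (capmx_idPl W'M) rW'.
  apply: leq_trans (hW k ks) _; apply: mxrankS.
  by apply: capmxS => //; apply: addsmxSl.
have [WC SC rC hCk] := hC j.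
have := mxrank_sum_cap (W + e)%MS (S j k); rewrite rW'.
have : (\rank (W + e + S j k)%MS <= \rank (C j + S j k)%MS)%N.
  by apply: mxrankS; apply: addsmxS => //; rewrite addsmx_sub WC eC.
have := hCk k kr; lia.
Qed.
End Subspaces.

(** * Traces of compressions of Hermitian forms *)

Section Forms.
Local Open Scope sesquilinear_scope.
Variable (C : numClosedFieldType).
Local Notation "''[' u , v ]" := (dotmx u v) : ring_scope.
Local Notation "''[' u ]" := '[u, u] : ring_scope.

(** The [k]-th vector is taken in [W :&: S k], orthogonally to the [k] earlier
    ones: the dimension hypothesis leaves at least a line. *)
Lemma exists_adapted_basis n r (W : 'M[C]_n) (S : nat -> 'M[C]_n) :
  (forall k, (k < r)%N -> (k < \rank (W :&: S k)%MS)%N) ->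
  exists B : 'M[C]_(r, n), [/\ B \is unitarymx, (B <= W)%MS &
    forall i, (row i B <= S i)%MS].
Proof.
move=> hS.
suff [f [fo fW fS]] : exists f : nat -> 'rV[C]_n,
    [/\ forall i j, (i < r)%N -> (j < r)%N -> '[f i, f j] = (i == j)%:R,
        forall i, (i < r)%N -> (f i <= W)%MS &
        forall i, (i < r)%N -> (f i <= S i)%MS].
  exists (\matrix_i f i); split.
  - by apply/row_unitarymxP => i j; rewrite !rowK fo.
  - by apply/row_subP => i; rewrite rowK fW.
  - by move=> i; rewrite rowK fS.
elim: r hS => [|r IH] hS; first by exists (fun=> 0).
have [k kr|f [fo fW fS]] := IH; first by rewrite hS // ltnW.
pose K := kermx ((\matrix_(i < r) f i)^t*).
have rK : (n <= \rank K + r)%N.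
  rewrite mxrank_ker -leq_subLR; have := rank_leq_col ((\matrix_(i < r) f i)^t*).
  lia.
have : ((W :&: S r) :&: K)%MS != 0.
  rewrite -mxrank_eq0; have := mxrank_cap_geq (W :&: S r)%MS K.
  have := hS r (ltnSn r); lia.
case/rowV0Pn => v; rewrite !sub_capmx => /andP[/andP[vW vS] vK] v0.
have vf i : (i < r)%N -> '[v, f i] = 0.
  move=> ir; move/sub_kermxP: vK => /rowP/(_ (Ordinal ir)).
  rewrite !mxE => vf0; rewrite dotmxE mxE -[RHS]vf0; apply: eq_bigr => k _.
  by rewrite !mxE.
have fv i : (i < r)%N -> '[f i, v] = 0.
  by move=> ir; rewrite hermC /= vf // rmorph0 mulr0.
have vgt0 : 0 < '[v] by rewrite dnorm_gt0.
pose u := (sqrtC '[v])^-1 *: v.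
exists (fun k => if k == r then u else f k); split.
- move=> i j; rewrite !ltnS => ir jr.
  case: eqP => [->|/eqP ir']; case: eqP => [->|/eqP jr'].
  + rewrite /u dnormZ gtr0_norm ?invr_gt0 ?sqrtC_gt0 //.
    by rewrite exprVn sqrtCK eqxx mulVf // gt_eqF.
  + by rewrite /u linearZl_LR /= vf ?mulr0 ?[r == j]eq_sym ?(negPf jr') //
         ltn_neqAle jr'.
  + by rewrite /u linearZr_LR /= fv ?mulr0 ?(negPf ir') // ltn_neqAle ir'.
  + by rewrite fo // ltn_neqAle ?ir' ?jr'.
- move=> i; rewrite ltnS => ir; case: eqP => [_|/eqP ir']; first exact: scalemx_sub.
  by rewrite fW // ltn_neqAle ir'.
- move=> i; rewrite ltnS => ir; case: eqP => [->|/eqP ir']; first exact: scalemx_sub.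
  by rewrite fS // ltn_neqAle ir'.
Qed.

Lemma mxtrace_compression n r (B : 'M[C]_(r, n)) (G : 'M_n) :
  \tr (B *m G *m B^t*) = \sum_i '[row i B *m G, row i B].
Proof.
apply: eq_bigr => i _; rewrite dotmxE -row_mul !mxE; apply: eq_bigr => k _.
by rewrite !mxE.
Qed.

Lemma mxtrace_compression_eq n r (W : 'M[C]_n) (B1 B2 : 'M[C]_(r, n)) (G : 'M_n) :
  B1 \is unitarymx -> B2 \is unitarymx -> (B1 <= W)%MS -> (B2 <= W)%MS ->
  \rank W = r -> \tr (B1 *m G *m B1^t*) = \tr (B2 *m G *m B2^t*).
Proof.
move=> U1 U2 B1W B2W rW.
have WB2 : (W <= B2)%MS.
  by rewrite -(mxrank_leqif_sup B2W) rW mxrank_unitary.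
have /submxP[X B1E] := submx_trans B1W WB2.
have XX : X *m X^t* = 1%:M.
  have := unitarymxP U1.
  by rewrite B1E trmx_mul map_mxM mulmxA -(mulmxA X) (unitarymxP U2) mulmx1.
rewrite B1E trmx_mul map_mxM !mulmxA mxtrace_mulC !mulmxA.
by rewrite (mulmx1C XX) mul1mx.
Qed.

(** The trace of [G] compressed to the common subspace [W] is bounded below
    by [lam] in an orthonormal basis adapted to the flag [M], and, for each
    summand, above by [mu j] in a basis adapted to [S j]: the compressed trace
    does not depend on the basis, so the bounds can be chained.  For [m = 2] and
    the flags of eigenvectors these are the Thompson-Freede inequalities for
    the eigenvalues of a sum (with equal index shifts). *)
Lemma sum_eigen_le_of_flags m n r (a : nat -> nat) (G : 'I_m -> 'M[C]_n)
    (lam : nat -> C) (M : nat -> 'M[C]_n)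
    (mu : 'I_m -> nat -> C) (S : 'I_m -> nat -> 'M[C]_n) :
  (forall i, (i < n)%N -> (i < \rank (M i))%N) ->
  (forall i i', (i <= i')%N -> (M i <= M i')%MS) ->
  (forall i x, (i < n)%N -> (x <= M i)%MS ->
     lam i * '[x] <= '[x *m \sum_j G j, x]) ->
  (forall j i, (n <= \rank (S j i) + i)%N) ->
  (forall j i i', (i <= i')%N -> (S j i' <= S j i)%MS) ->
  (forall j i x, (i < n)%N -> (x <= S j i)%MS -> '[x *m G j, x] <= mu j i * '[x]) ->
  (0 < m)%N ->
  (forall k, (k.+1 < r)%N -> (a k < a k.+1)%N) ->
  (forall k, (k < r)%N -> (m * (a k - k) + k < n)%N) ->
  \sum_(k < r) lam (m * (a k - k) + k)%N <= \sum_j \sum_(k < r) mu j (a k).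
Proof.
move=> rM MM qM rS SS qS m0 ha an.
have hak k : (k < r)%N -> (k <= a k)%N.
  by elim: k => // k IH kr; apply: leq_ltn_trans (IH (ltnW kr)) (ha k kr).
have [|||||W [rW WM WS]] := @exists_common_subspace C n m r a
    (fun k => M (m * (a k - k) + k)%N) (fun j k => S j (a k)).
- exact: ha.
- by move=> k kr; apply: rM; apply: an.
- move=> k kr; apply: MM; apply: leq_add => //; rewrite leq_mul2l.
  by apply/orP; right; have := ha k kr; lia.
- by move=> j k _; apply: rS.
- by move=> j k kr; apply: SS; apply/ltnW/ha.
have [B [UB BW BM]] := exists_adapted_basis WM.
have hB : \sum_(k < r) lam (m * (a k - k) + k)%N <= \tr (B *m (\sum_j G j) *m B^t*).
  rewrite mxtrace_compression; apply: ler_sum => i _.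
  apply: le_trans (qM _ _ (an i (ltn_ord i)) (BM i)).
  by rewrite (row_unitarymxP UB) eqxx mulr1.
apply: le_trans hB _.
rewrite mulmx_sumr mulmx_suml raddf_sum /=; apply: ler_sum => j _.
(* [exists_adapted_basis] wants the small intersections first, hence the
   reversal of the order of the flag. *)
have [|D [UD DW DS]] := @exists_adapted_basis n r W (fun k => S j (a (r - k.+1)%N)).
  move=> k kr; have := WS j (r - k.+1)%N; lia.
rewrite (mxtrace_compression_eq (G j) UB UD BW DW rW) mxtrace_compression.
rewrite [leRHS](reindex_inj rev_ord_inj) /=; apply: ler_sum => i _.
apply: le_trans (qS _ _ _ _ (DS i)) _.
  have := an (r - i.+1)%N; have := hak (r - i.+1)%N; have := ltn_ord i; nia.
by rewrite (row_unitarymxP UD) eqxx mulr1.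
Qed.
End Forms.

(** * Eigenvalues of sums of Gram matrices *)

Section Eigen.
Local Open Scope sesquilinear_scope.
Variable (C : numClosedFieldType).
Local Notation "''[' u , v ]" := (dotmx u v) : ring_scope.
Local Notation "''[' u ]" := '[u, u] : ring_scope.

Definition diag_seq n (d : nat -> C) : 'M[C]_n := diag_mx (\row_i d i).

Lemma dotmx_mul_adj n p (x : 'rV[C]_p) (A : 'M[C]_(n, p)) (y : 'rV[C]_n) :
  '[x *m A^t*, y] = '[x, y *m A].
Proof. by rewrite !dotmxE trmx_mul map_mxM mulmxA. Qed.

Lemma dotmx_mulr n p (x : 'rV[C]_p) (A : 'M[C]_(p, n)) (y : 'rV[C]_n) :
  '[x *m A, y] = '[x, y *m A^t*].
Proof. by rewrite -[A in LHS]trmxCK dotmx_mul_adj. Qed.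

Lemma dotmx_diag n (y : 'rV[C]_n) d :
  '[y *m diag_seq n d, y] = \sum_(k < n) d k * `|y 0 k| ^+ 2.
Proof.
rewrite dotmxE mxE; apply: eq_bigr => k _.
by rewrite mul_mx_diag !mxE normCK mulrA [d k * _]mulrC.
Qed.

Lemma dotmx_eigen n (U G : 'M[C]_n) d x :
  G = U^t* *m diag_seq n d *m U ->
  '[x *m G, x] = \sum_(k < n) d k * `|(x *m U^t*) 0 k| ^+ 2.
Proof.
move=> ->; rewrite -dotmx_diag !mulmxA.
by rewrite dotmx_mulr.
Qed.

Lemma dotmx_unitary n (U : 'M[C]_n) x :
  U \is unitarymx -> '[x] = \sum_(k < n) `|(x *m U^t*) 0 k| ^+ 2.
Proof.
move=> UU; rewrite -[x in '[x, _]]mulmx1 (@dotmx_eigen n U 1%:M (fun=> 1)).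
  by apply: eq_bigr => k _; rewrite mul1r.
have -> : diag_seq n (fun=> 1) = 1%:M.
  by apply/matrixP => i j; rewrite !mxE.
by rewrite mulmx1 (mulmx1C (unitarymxP UU)).
Qed.

Lemma mul_row_pid n i (y : 'rV[C]_n) k :
  (y *m (pid_mx i : 'M_n)) 0 k = y 0 k *+ (k < i)%N.
Proof.
rewrite mxE (bigD1 k) //= mxE eqxx /= big1 ?addr0.
  by case: (k < i)%N; rewrite ?mulr1 ?mulr0.
by move=> l lk; rewrite mxE -val_eqE /= in lk *; rewrite (negPf lk) mulr0.
Qed.

(** The rows whose image under [B] is supported on the indices [>= i], resp.
    [<= i].  When [B] is the adjoint of a unitary matrix of eigenvectors, this
    image is the coordinate vector, and the flags are those of spans of
    eigenvectors. *)
Definition bottom_flag n (B : 'M[C]_n) i : 'M_n := kermx (B *m (pid_mx i : 'M_n)).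
Definition top_flag n (B : 'M[C]_n) i : 'M_n := kermx (B *m copid_mx i.+1).

Lemma bottom_flagP n (B : 'M[C]_n) i (x : 'rV_n) (k : 'I_n) :
  (x <= bottom_flag B i)%MS -> (k < i)%N -> (x *m B) 0 k = 0.
Proof.
move=> /sub_kermxP; rewrite mulmxA => /rowP/(_ k).
rewrite mul_row_pid [RHS]mxE => h ki.
by rewrite ki in h.
Qed.

Lemma top_flagP n (B : 'M[C]_n) i (x : 'rV_n) (k : 'I_n) :
  (x <= top_flag B i)%MS -> (i < k)%N -> (x *m B) 0 k = 0.
Proof.
move=> /sub_kermxP; rewrite mulmxA mulmxBr mulmx1 => /eqP.
rewrite subr_eq0 => /eqP-> ik; rewrite mul_row_pid ltnS leqNgt ik //.
Qed.

Lemma mxrank_bottom_flag n (B : 'M[C]_n) i : (n <= \rank (bottom_flag B i) + i)%N.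
Proof.
rewrite mxrank_ker.
have h : (\rank (B *m (pid_mx i : 'M_n)) <= i)%N.
  apply: leq_trans (mxrankM_maxr _ _) _; case: (leqP i n) => [h|/ltnW h].
    by rewrite rank_pid_mx.
  exact: leq_trans (rank_leq_row _) h.
lia.
Qed.

Lemma mxrank_top_flag n (B : 'M[C]_n) i : (i < n)%N -> (i < \rank (top_flag B i))%N.
Proof.
move=> ilt; rewrite mxrank_ker.
have h : (\rank (B *m (copid_mx i.+1 : 'M_n)) <= n - i.+1)%N.
  by apply: leq_trans (mxrankM_maxr _ _) _; rewrite rank_copid_mx.
lia.
Qed.

Lemma bottom_flagS n (B : 'M[C]_n) i i' : (i <= i')%N ->
  (bottom_flag B i' <= bottom_flag B i)%MS.
Proof.
move=> ii; apply/sub_kermxP.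
have -> : (pid_mx i : 'M[C]_n) = (pid_mx i' : 'M_n) *m pid_mx i.
  by rewrite mul_pid_mx (minn_idPr ii) pid_mx_minv.
by rewrite !mulmxA -[_ *m B *m _]mulmxA mulmx_ker mul0mx.
Qed.

Lemma top_flagS n (B : 'M[C]_n) i i' : (i <= i')%N ->
  (top_flag B i <= top_flag B i')%MS.
Proof.
move=> ii; apply/sub_kermxP.
have -> : (copid_mx i'.+1 : 'M[C]_n) = (copid_mx i.+1 : 'M_n) *m copid_mx i'.+1.
  rewrite /copid_mx mulmxBl mul1mx mulmxBr mulmx1 mul_pid_mx.
  by rewrite (@minn_idPl i.+1 i'.+1 _) // pid_mx_minv subrr subr0.
by rewrite !mulmxA -[_ *m B *m _]mulmxA mulmx_ker mul0mx.
Qed.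

Lemma dotmx_top_flag n (U G : 'M[C]_n) d i (x : 'rV_n) :
  U \is unitarymx -> G = U^t* *m diag_seq n d *m U ->
  (forall k k', (k <= k' < n)%N -> d k' <= d k) -> (i < n)%N ->
  (x <= top_flag (U^t* ) i)%MS -> d i * '[x] <= '[x *m G, x].
Proof.
move=> UU GE dd ilt xi; rewrite (dotmx_eigen _ GE) (dotmx_unitary _ UU) mulr_sumr.
apply: ler_sum => k _; case: (leqP k i) => ki.
  by rewrite ler_wpM2r ?exprn_ge0 // dd // ki.
by rewrite (top_flagP xi ki) normr0 expr0n !mulr0.
Qed.

Lemma dotmx_bottom_flag n (U G : 'M[C]_n) d i (x : 'rV_n) :
  U \is unitarymx -> G = U^t* *m diag_seq n d *m U ->
  (forall k k', (k <= k' < n)%N -> d k' <= d k) -> (i < n)%N ->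
  (x <= bottom_flag (U^t* ) i)%MS -> '[x *m G, x] <= d i * '[x].
Proof.
move=> UU GE dd ilt xi; rewrite (dotmx_eigen _ GE) (dotmx_unitary _ UU) mulr_sumr.
apply: ler_sum => k _; case: (ltnP k i) => ki.
  by rewrite (bottom_flagP xi ki) normr0 expr0n !mulr0.
by rewrite ler_wpM2r ?exprn_ge0 // dd // ki ltn_ord.
Qed.

(** The eigenvalues of [A^t* *m A] are those of [A *m A^t*]; here is the half of
    this fact that matters, in terms of flags.  For [x] in the flag, [y] is the
    image of [x] under the adjoint of [A], lies in the span of the eigenvectors
    of index [>= i], and satisfies [ |y A|^2 <= d i |y|^2 ].  Expanding
    [ 0 <= |y A - d i x|^2 ] turns this into [ |y|^2 <= d i |x|^2 ]. *)
Lemma dotmx_bottom_flag_adj n (U A : 'M[C]_n) d i (x : 'rV_n) :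
  U \is unitarymx -> A *m A^t* = U^t* *m diag_seq n d *m U ->
  (forall k k', (k <= k' < n)%N -> d k' <= d k) -> (forall k, 0 <= d k) ->
  (i < n)%N -> (x <= bottom_flag (A^t* *m U^t*) i)%MS ->
  '[x *m (A^t* *m A), x] <= d i * '[x].
Proof.
move=> UU GE dd d0 ilt xi; pose y := x *m A^t*.
have yi : (y <= bottom_flag (U^t* ) i)%MS.
  by apply/sub_kermxP; rewrite /y !mulmxA; move/sub_kermxP: xi; rewrite !mulmxA.
have yA : '[y *m A] <= d i * '[y].
  by rewrite -dotmx_mul_adj -mulmxA; apply: dotmx_bottom_flag UU GE dd ilt yi.
have E : '[x *m (A^t* *m A), x] = '[y].
  by rewrite mulmxA dotmx_mulr.
have yx : '[y *m A, x] = '[y] by rewrite -E mulmxA.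
rewrite E; have := d0 i; rewrite le_eqVlt => /predU1P[d0'|dgt0].
  have : '[y *m A] == 0 by rewrite eq_le dnorm_ge0 andbT; rewrite -d0' mul0r in yA.
  by rewrite dnorm_eq0 => /eqP yA0; rewrite -yx yA0 linear0l mulr_ge0 ?dnorm_ge0.
have di : (d i)^* = d i by apply/CrealP/ger0_real.
have dyx : '[y *m A, d i *: x] = d i * '[y] by rewrite linearZr_LR /= yx di.
have := dnorm_ge0 (@dotmx C n) (y *m A - d i *: x).
rewrite dnormB /= dyx dnormZ ger0_norm //.
rewrite rmorphM /= di.
have -> : '[y]^* = '[y] by apply/CrealP/ger0_real/dnorm_ge0.
move=> h; rewrite -(ler_pM2l dgt0).
rewrite -subr_ge0; apply: le_trans h _; rewrite -subr_ge0.
by move: yA; rewrite -subr_ge0; congr (0 <= _); ring.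
Qed.

Lemma diag_seq_conjE n (U : 'M[C]_n) d a b :
  (U^t* *m diag_seq n d *m U) a b = \sum_(k < n) (U k a)^* * d k * U k b.
Proof.
rewrite mxE; apply: eq_bigr => k _; by rewrite mul_mx_diag !mxE.
Qed.

(** The spectral theorem, with the eigenvectors permuted so that the
    eigenvalues, which are nonnegative, come in decreasing order. *)
Lemma exists_sorted_spectrum n (A : 'M[C]_n) : exists (U : 'M[C]_n) (d : nat -> C),
  [/\ U \is unitarymx, A *m A^t* = U^t* *m diag_seq n d *m U,
      forall k, 0 <= d k & forall k k', (k <= k' < n)%N -> d k' <= d k].
Proof.
set G := A *m A^t*.
have /orthomx_spectralP : G \is normalmx.
  apply/normalmxP; rewrite /G !trmx_mul !map_mxM; congr (_ *m _); rewrite ?trmxCK //.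
set P := spectralmx G; set sp := spectral_diag G => GE.
have UP : P \is unitarymx by apply: spectral_unitarymx.
rewrite invmx_unitary // in GE.
have sp0 k : 0 <= sp 0 k.
  have -> : sp 0 k = '[row k P *m A].
    rewrite -dotmx_mul_adj -mulmxA -/G -row_mul GE !mulmxA (unitarymxP UP) mul1mx.
    rewrite row_mul row_diag_mx -scalemxAl -rowE linearZl_LR /=.
    by rewrite (row_unitarymxP UP) eqxx mulr1.
  exact: dnorm_ge0.
pose geC := fun x y : C => y <= x.
pose sq := [tuple sp 0 k | k < n].
have sq0 x : x \in sq -> 0 <= x.
  by move=> /tnthP[k ->]; rewrite tnth_mktuple.
have : perm_eq (sort geC sq) sq by rewrite perm_sort.
case/tuple_permP => s tE.
have st : size (sort geC sq) = n by rewrite size_sort size_tuple.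
have sorted_t : sorted geC (sort geC sq).
  apply: (@sort_sorted_in _ (fun x => 0 <= x)); last by apply/allP.
  by move=> x y x0 y0; rewrite /geC orbC; apply: real_leVge; apply: ger0_real.
have geC_trans : transitive geC.
  by move=> x y z; rewrite /geC => h1 h2; apply: le_trans h2 h1.
have nthE (k : 'I_n) : nth 0 (sort geC sq) k = sp 0 (s k).
  by rewrite tE -tnth_nth !tnth_mktuple.
exists (row_perm s P), (nth 0 (sort geC sq)); split.
- apply/row_unitarymxP => i j.
  have rE l : row l (row_perm s P) = row (s l) P by apply/rowP => b; rewrite !mxE.
  rewrite !rE (row_unitarymxP UP).
  by rewrite (inj_eq perm_inj).
- apply/matrixP => a b; rewrite diag_seq_conjE GE mxE (reindex_perm s) /=.
  by apply: eq_bigr => k _; rewrite mul_mx_diag !mxE nthE.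
- move=> k; case: (ltnP k n) => kn; last by rewrite nth_default ?st.
  by rewrite (nthE (Ordinal kn)).
- move=> k k' /andP[kk' kn]; apply: (sorted_leq_nth geC_trans _ 0 sorted_t) => //.
  + by move=> x; rewrite /geC.
  + by rewrite inE st (leq_ltn_trans kk').
  + by rewrite inE st.
Qed.

Definition eigenvalues_of n (G : 'M[C]_n) (lam : nat -> C) :=
  (forall k k', (k <= k' < n)%N -> lam k' <= lam k) /\
  exists2 U : 'M[C]_n, U \is unitarymx & G = U^t* *m diag_seq n lam *m U.

Lemma mxtrace_eigenvalues n (G : 'M[C]_n) lam :
  eigenvalues_of G lam -> \tr G = \sum_(i < n) lam i.
Proof.
case=> _ [U UU ->]; rewrite mxtrace_mulC mulmxA (unitarymxP UU) mul1mx.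
by rewrite /diag_seq mxtrace_diag; apply: eq_bigr => i _; rewrite mxE.
Qed.

(** One family [mu] bounds the eigenvalue sums of both Gram sums: [mu j] is the
    sorted spectrum of [A j *m (A j)^t*], which is also that of
    [(A j)^t* *m A j]. *)
Lemma gram_sums_eigen_le m n (A : 'I_m -> 'M[C]_n) : (0 < m)%N ->
  exists mu : 'I_m -> nat -> C,
  [/\ forall j i, 0 <= mu j i,
      \sum_j \sum_(i < n) mu j i = \tr (\sum_j (A j)^t* *m A j) &
      forall G lam r (a : nat -> nat),
        G = \sum_j A j *m (A j)^t* \/ G = \sum_j (A j)^t* *m A j ->
        eigenvalues_of G lam ->
        (forall k, (k.+1 < r)%N -> (a k < a k.+1)%N) ->
        (forall k, (k < r)%N -> (m * (a k - k) + k < n)%N) ->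
        \sum_(k < r) lam (m * (a k - k) + k)%N <= \sum_j \sum_(k < r) mu j (a k)].
Proof.
move=> m0.
have [U hU] := fin_all_exists (fun j => exists_sorted_spectrum (A j)).
have [mu hmu] := fin_all_exists hU.
exists mu; split.
- by move=> j i; case: (hmu j).
- rewrite raddf_sum /=; apply: eq_bigr => j _; have [Uj E d0 dd] := hmu j.
  by rewrite mxtrace_mulC; apply/esym/mxtrace_eigenvalues; split => //; exists (U j).
move=> G lam r a GE [ll [V UV GV]] ha an.
have tops i (x : 'rV_n) : (i < n)%N -> (x <= top_flag (V^t* ) i)%MS ->
  lam i * '[x] <= '[x *m G, x] by move=> ilt; exact: (dotmx_top_flag UV GV ll ilt).
case: GE tops => -> tops.
- apply: (@sum_eigen_le_of_flags C m n r a (fun j => A j *m (A j)^t* ) lam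
    (top_flag (V^t* )) mu (fun j => bottom_flag ((U j)^t* ))) => //.
  + by move=> i; apply: mxrank_top_flag.
  + by move=> i i'; apply: top_flagS.
  + by move=> j i; apply: mxrank_bottom_flag.
  + by move=> j i i'; apply: bottom_flagS.
  + move=> j i x ilt; have [Uj E d0 dd] := hmu j.
    exact: (dotmx_bottom_flag Uj E dd ilt).
- apply: (@sum_eigen_le_of_flags C m n r a (fun j => (A j)^t* *m A j) lam
    (top_flag (V^t* )) mu (fun j => bottom_flag ((A j)^t* *m (U j)^t* ))) => //.
  + by move=> i; apply: mxrank_top_flag.
  + by move=> i i'; apply: top_flagS.
  + by move=> j i; apply: mxrank_bottom_flag.
  + by move=> j i i'; apply: bottom_flagS.
  + move=> j i x ilt; have [Uj E d0 dd] := hmu j.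
    exact: (dotmx_bottom_flag_adj Uj E dd d0 ilt).
Qed.
End Eigen.

(** * Padding with zeros *)

Section Padding.
Local Open Scope sesquilinear_scope.
Variable C : numClosedFieldType.

Lemma adj_pid_mx n1 n r : (pid_mx r : 'M[C]_(n1, n))^t* = pid_mx r.
Proof. by rewrite tr_pid_mx map_pid_mx. Qed.

(** The unitary matrix of eigenvectors is completed by an identity block. *)
Lemma eigenvalues_of_pad n1 n (G : 'M[C]_n1) lam :
  (n1 <= n)%N -> (forall k, 0 <= lam k) -> (forall k, (n1 <= k)%N -> lam k = 0) ->
  eigenvalues_of G lam ->
  eigenvalues_of ((pid_mx n1 : 'M_(n, n1)) *m G *m (pid_mx n1 : 'M_(n1, n))) lam.
Proof.
move=> le_n lam0 lamz [ll [U UU GE]]; split.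
  move=> k k' /andP[kk' kn]; case: (ltnP k' n1) => k'n; last by rewrite lamz.
  by rewrite ll // kk'.
move: le_n => /subnKC <-; move: (n - n1)%N => k {n}.
exists (block_mx U 0 0 1%:M).
  apply/unitarymxP; rewrite tr_block_mx map_block_mx mulmx_block !trmx0 !map_mx0.
  rewrite !mulmx0 !mul0mx !addr0 !add0r (unitarymxP UU) trmx1 map_mx1 mulmx1.
  by rewrite -scalar_mx_block.
have DE : diag_seq (n1 + k) lam =
    (pid_mx n1 : 'M_(n1 + k, n1)) *m diag_seq n1 lam *m (pid_mx n1 : 'M_(n1, n1 + k)).
  rewrite pid_mx_col pid_mx_row mul_col_mx mul1mx mul0mx mul_col_row !mulmx1 !mulmx0.
  rewrite -[X in block_mx _ _ _ X](_ : diag_mx 0 = _); last first.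
    by apply/matrixP => i j; rewrite !mxE mul0rn.
  rewrite /diag_seq -diag_mx_row; congr diag_mx; apply/rowP => i; rewrite !mxE.
  by case: splitP => j E; rewrite !mxE E // lamz // leq_addr.
have UE : (pid_mx n1 : 'M_(n1, n1 + k)) *m block_mx U 0 0 1%:M = U *m pid_mx n1.
  rewrite pid_mx_row mul_row_block mul_mx_row mulmx1 mul1mx mulmx0 !addr0 mul0mx.
  by rewrite mulmx0 addr0 mulmx1.
rewrite DE !mulmxA -(mulmxA _ (pid_mx n1 : 'M_(n1, n1 + k))) UE.
have := congr1 (fun X => X^t*) UE; rewrite !trmx_mul !map_mxM !adj_pid_mx => ->.
by rewrite GE !mulmxA.
Qed.

Lemma pid_mx_isometry n1 n : (n1 <= n)%N ->
  (pid_mx n1 : 'M[C]_(n1, n)) *m (pid_mx n1 : 'M_(n, n1)) = 1%:M.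
Proof. by move=> le_n; rewrite mul_pid_mx minnn (minn_idPr le_n) pid_mx_1. Qed.

Lemma sum_pad_gram m n1 n2 n (A : 'I_m -> 'M[C]_(n1, n2)) :
  (n1 <= n)%N -> (n2 <= n)%N ->
  let B j := (pid_mx n1 : 'M_(n, n1)) *m A j *m (pid_mx n2 : 'M_(n2, n)) in
  \sum_j B j *m (B j)^t* =
    (pid_mx n1 : 'M_(n, n1)) *m (\sum_j A j *m (A j)^t*) *m (pid_mx n1 : 'M_(n1, n)).
Proof.
move=> le1 le2 B; rewrite mulmx_sumr mulmx_suml; apply: eq_bigr => j _.
rewrite /B !trmx_mul !map_mxM !adj_pid_mx !mulmxA.
by rewrite -(mulmxA _ (pid_mx n2) (pid_mx n2)) pid_mx_isometry // mulmx1.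
Qed.

Lemma sum_pad_gram_adj m n1 n2 n (A : 'I_m -> 'M[C]_(n1, n2)) :
  (n1 <= n)%N -> (n2 <= n)%N ->
  let B j := (pid_mx n1 : 'M_(n, n1)) *m A j *m (pid_mx n2 : 'M_(n2, n)) in
  \sum_j (B j)^t* *m B j =
    (pid_mx n2 : 'M_(n, n2)) *m (\sum_j (A j)^t* *m A j) *m (pid_mx n2 : 'M_(n2, n)).
Proof.
move=> le1 le2 B; rewrite mulmx_sumr mulmx_suml; apply: eq_bigr => j _.
rewrite /B !trmx_mul !map_mxM !adj_pid_mx !mulmxA.
by rewrite -(mulmxA _ (pid_mx n1) (pid_mx n1)) pid_mx_isometry // mulmx1.
Qed.
End Padding.

(** * Singular values of the matricizations *)

Section SingularValues.
Local Open Scope sesquilinear_scope.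
Variable R : realType.
Local Notation inC := (real_complex R).

Lemma has_singular_values_complex p q (M : 'M[R]_(p, q)) s :
  has_singular_values id id M s ->
  has_singular_values inC (@conjc R) (map_mx inC M) s.
Proof.
case=> sd s0 sz [U [V [UU UV ME]]].
have mapt k l (X : 'M[R]_(k, l)) :
    (map_mx inC X)^t (@conjc R) = map_mx inC (X^t id).
  by apply/matrixP => i j; rewrite !mxE conjc_real.
have uni k (X : 'M[R]_k) : unitary id X -> unitary (@conjc R) (map_mx inC X).
  by rewrite /unitary mapt -map_mxM => ->; rewrite map_mx1.
split => //; exists (map_mx inC U), (map_mx inC V); split; try exact: uni.
rewrite mapt ME !map_mxM; congr (_ *m _ *m _).
by apply/matrixP => i j; rewrite !mxE rmorphMn.
Qed.

(** Real singular value decompositions are complex ones, so only the complex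
    spectral theorem is needed. *)
Lemma feasible_complex K m (gamma theta : nat -> R) :
  feasible K m gamma theta -> feasible ComplexScalars m gamma theta.
Proof.
case: K => // -[A [h1 h2]]; exists (fun i j k => inC (A i j k)); split.
  have -> : mat1 (fun i j k => inC (A i j k)) = map_mx inC (mat1 A).
    by apply/matrixP => i j; rewrite !mxE.
  exact: has_singular_values_complex.
have -> : mat12 (fun i j k => inC (A i j k)) = map_mx inC (mat12 A).
  by apply/matrixP => i j; rewrite !mxE.
exact: has_singular_values_complex.
Qed.

Lemma adj_diag_rect p q s :
  (diag_rect inC p q s)^t* = diag_rect inC q p s.
Proof.
apply/matrixP => i j; rewrite !mxE rmorphMn /= eq_sym.
case: eqP => [->|_]; rewrite ?mulr0n //; congr (_ *+ _); exact: conjc_real.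
Qed.

Lemma diag_rect_gram p q s : (forall i, (minn p q <= i)%N -> s i = 0) ->
  diag_rect inC p q s *m (diag_rect inC p q s)^t* =
  diag_seq p (fun k => inC (s k ^+ 2)).
Proof.
move=> sz; rewrite adj_diag_rect; apply/matrixP => a b; rewrite !mxE.
case: (ltnP a q) => aq; last first.
  rewrite big1 => [|k _]; first by rewrite sz ?expr0n ?mul0rn // geq_min aq orbT.
  by rewrite mxE gtn_eqF ?mul0r // (leq_trans (ltn_ord k)).
rewrite (bigD1 (Ordinal aq)) //= big1 => [|k ka]; last first.
  rewrite mxE; case: eqP => [E|]; last by rewrite mul0r.
  by case/eqP: ka; apply: val_inj.
rewrite !mxE eqxx mulr1n addr0 /= -(inj_eq val_inj) /=.
by case: eqP => _; rewrite ?mulr0 // !mulr1n -rmorphM.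
Qed.

Lemma has_singular_values_adj p q (M : 'M[R[i]]_(p, q)) s :
  has_singular_values inC (@conjc R) M s ->
  has_singular_values inC (@conjc R) (M^t*) s.
Proof.
case=> sd s0 sz [U [V [UU UV ME]]]; split; rewrite 1?minnC //.
exists V, U; split; [by [] | by [] | rewrite ME !trmx_mul !map_mxM mulmxA].
have VK : (V^t (@conjc R))^t* = V by exact: (trmxCK V).
by rewrite VK (adj_diag_rect p q s).
Qed.

Lemma gram_singular_values p q (M : 'M[R[i]]_(p, q)) s :
  has_singular_values inC (@conjc R) M s ->
  eigenvalues_of (M *m M^t*) (fun k => inC (s k ^+ 2)).
Proof.
case=> sd s0 sz [U [V [UU UV ME]]]; split.
  move=> k k' /andP[kk' _]; rewrite lecR; apply: lerXn2r; rewrite ?nnegrE //.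
  exact: sd.
have UU' : U \is unitarymx by apply/unitarymxP.
exists (U^t* ); first by rewrite trmxC_unitary.
rewrite trmxCK -(diag_rect_gram sz) ME !trmx_mul !map_mxM trmxCK !mulmxA.
by rewrite -(mulmxA _ (V^t* ) V) (_ : V^t* *m V = 1%:M) ?mulmx1 //; exact: mulmx1C.
Qed.

Lemma mat1_gram n1 m n2 (A : 'I_n1 -> 'I_m -> 'I_n2 -> R[i]) :
  mat1 A *m (mat1 A)^t* =
  \sum_j (\matrix_(i, k) A i j k) *m (\matrix_(i, k) A i j k)^t*.
Proof.
have -> : (mat1 A)^t* = \mxcol_j (\matrix_(i, k) A i j k)^t*.
  by apply/matrixP => a b; rewrite !mxE.
exact: mul_mxrow_mxcol.
Qed.

Lemma mat12_gram n1 m n2 (A : 'I_n1 -> 'I_m -> 'I_n2 -> R[i]) :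
  (mat12 A)^t* *m mat12 A =
  \sum_j (\matrix_(i, k) A i j k)^t* *m (\matrix_(i, k) A i j k).
Proof.
have -> : (mat12 A)^t* = \mxrow_j (\matrix_(i, k) A i j k)^t*.
  by apply/matrixP => a b; rewrite !mxE.
exact: mul_mxrow_mxcol.
Qed.

(** [nu k] is the sum over the slices of the [k]-th squared singular values.
    The slices are padded with zeros to [n] x [n] matrices, so that both
    matricizations yield sums of [n] x [n] Gram matrices and [n] can be taken
    larger than every index in play. *)
Lemma feasible_sums K m (gamma theta : nat -> R) :
  (0 < m)%N -> feasible K m gamma theta ->
  exists n0, forall n, (n0 <= n)%N ->
  exists nu : nat -> R,
  [/\ forall k, 0 <= nu k,
      \sum_(k < n) nu k = \sum_(k < n) theta k ^+ 2 &
      forall v r (a : nat -> nat), v = gamma \/ v = theta ->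
        (forall k, (k.+1 < r)%N -> (a k < a k.+1)%N) ->
        (forall k, (k < r)%N -> (m * (a k - k) + k < n)%N) ->
        \sum_(k < r) v (m * (a k - k) + k)%N ^+ 2 <= \sum_(k < r) nu (a k)].
Proof.
move=> m0 /feasible_complex[A [svg svt]].
have [gd g0 gz _] := svg; have [td t0 tz _] := svt.
set n1 := deg gamma in A svg svt gz tz *; set n2 := deg theta in A svg svt gz tz *.
exists (maxn n1 n2) => n; rewrite geq_max => /andP[le1 le2].
pose X j := \matrix_(i < n1, k < n2) A i j k.
pose B j : 'M[R[i]]_n := (pid_mx n1 : 'M_(n, n1)) *m X j *m (pid_mx n2 : 'M_(n2, n)).
have sq0 (v : nat -> R) k : 0 <= inC (v k ^+ 2) by rewrite ler0c sqr_ge0.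
have eT : eigenvalues_of (\sum_j (B j)^t* *m B j) (fun k => inC (theta k ^+ 2)).
  rewrite (sum_pad_gram_adj X le1 le2); apply: eigenvalues_of_pad => // [k|].
    by move=> nk; rewrite tz ?expr0n ?geq_min ?nk ?orbT.
  have := gram_singular_values (has_singular_values_adj svt).
  by rewrite trmxCK mat12_gram.
have eG : eigenvalues_of (\sum_j B j *m (B j)^t*) (fun k => inC (gamma k ^+ 2)).
  rewrite (sum_pad_gram X le1 le2); apply: eigenvalues_of_pad => // [k|].
    by move=> nk; rewrite gz ?expr0n ?geq_min ?nk ?orbT.
  by have := gram_singular_values svg; rewrite mat1_gram.
have [mu [mu0 muT muS]] := gram_sums_eigen_le B m0.
have ReE (z : R[i]) : 0 <= z -> inC (complex.Re z) = z.
  by case: z => a b; rewrite lecE /= => /andP[/eqP-> _].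
pose nu k := \sum_j complex.Re (mu j k).
have nuE k : inC (nu k) = \sum_j mu j k.
  by rewrite rmorph_sum; apply: eq_bigr => j _; rewrite /= ReE.
exists nu; split.
- by move=> k; rewrite -ler0c nuE sumr_ge0.
- apply: (fmorph_inj inC); rewrite !rmorph_sum /=.
  rewrite -(mxtrace_eigenvalues eT) -muT [RHS]exchange_big /=.
  by apply: eq_bigr => k _; rewrite nuE.
move=> v r a vE ha an; rewrite -lecR !rmorph_sum /=.
rewrite [leRHS](eq_bigr (fun k : 'I_r => \sum_j mu j (a k))) => [|k _];
  last exact: nuE.
rewrite exchange_big /=.
case: vE => ->.
  exact: (muS _ _ r a (or_introl erefl) eG ha an).
exact: (muS _ _ r a (or_intror erefl) eT ha an).
Qed.
End SingularValues.

(** * The index sets *)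

Section Counting.
Local Open Scope nat_scope.
Implicit Types (P Q : pred nat) (a b N m : nat).

Definition count_below Q a := count Q (iota 0 a).

Lemma count_below_cat Q a b : a <= b ->
  count_below Q b = count_below Q a + count Q (iota a (b - a)).
Proof. by move=> ab; rewrite /count_below -count_cat -iotaD subnKC. Qed.

Lemma count_below_leq Q a b : a <= b -> count_below Q a <= count_below Q b.
Proof. by move=> /(count_below_cat Q) ->; apply: leq_addr. Qed.

Lemma count_below_ltn Q a b : Q a -> a < b -> count_below Q a < count_below Q b.
Proof.
move=> Qa ab; rewrite (count_below_cat Q (ltnW ab)).
by have -> : b - a = (b - a).-1.+1; rewrite /= ?Qa; lia.
Qed.

Lemma count_belowC Q a : count_below Q a + count_below (predC Q) a = a.
Proof. by rewrite /count_below count_predC size_iota. Qed.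

Lemma count_belowCC Q a : count_below (predC (predC Q)) a = count_below Q a.
Proof. by apply: eq_count => x /=; rewrite negbK. Qed.

Lemma count_below_bounded Q N a : (forall x, Q x -> x < N) -> N <= a ->
  count_below Q a = count_below Q N.
Proof.
move=> QN Na; rewrite (count_below_cat Q Na) (_ : count Q _ = 0) ?addn0 //.
apply/eqP; rewrite -leqn0 leqNgt -has_count; apply/hasPn => x.
rewrite mem_iota => /andP[Nx _]; apply/negP => /QN; lia.
Qed.

Lemma count_below_is_nth Q N a : a \in [seq x <- iota 0 N | Q x] ->
  index a [seq x <- iota 0 N | Q x] = count_below Q a.
Proof.
rewrite mem_filter mem_iota add0n => /andP[Qa /= aN].
have -> : N = a + (N - a).-1.+1 by lia.
rewrite iotaD filter_cat index_cat mem_filter mem_iota add0n ltnn !andbF.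
by rewrite /= Qa /= eqxx addn0 size_filter.
Qed.

Definition enum_below Q N := nth 0 [seq x <- iota 0 N | Q x].

Lemma enum_below_mem Q N k : k < count_below Q N ->
  Q (enum_below Q N k) /\ enum_below Q N k < N.
Proof.
move=> kN; have /(mem_nth 0) : k < size [seq x <- iota 0 N | Q x].
  by rewrite size_filter.
by rewrite -/(enum_below Q N k) mem_filter mem_iota => /andP[].
Qed.

Lemma count_enum_below Q N k : k < count_below Q N ->
  count_below Q (enum_below Q N k) = k.
Proof.
move=> kN; have ks : k < size [seq x <- iota 0 N | Q x] by rewrite size_filter.
rewrite -(@count_below_is_nth Q N) ?mem_nth // index_uniq //.
by rewrite filter_uniq ?iota_uniq.
Qed.

Lemma enum_below_ltn Q N k : k.+1 < count_below Q N ->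
  enum_below Q N k < enum_below Q N k.+1.
Proof.
move=> kN; have := count_enum_below kN; have := count_enum_below (ltnW kN).
case: leqP => // /(count_below_leq Q); lia.
Qed.

(** As [count_below Q a] is the rank of [a] in [Q], the set [Pset m Q] is the
    image of [Q] under this map, which multiplies every gap of [Q] by [m]. *)
Definition spread m Q a := m * (a - count_below Q a) + count_below Q a.

Lemma spreadE m Q a : spread m Q a = m * count_below (predC Q) a + count_below Q a.
Proof. by rewrite /spread -{1}[a](count_belowC Q) addKn. Qed.

Lemma spread_ltn m Q a b : Q a -> a < b -> spread m Q a < spread m Q b.
Proof.
move=> Qa ab; rewrite !spreadE -addnS leq_add ?count_below_ltn //.
by rewrite leq_mul2l count_below_leq ?orbT // ltnW.
Qed.

Lemma card_set_seq (T : choiceType) (s : seq T) :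
  uniq s -> ([set` s] #= `I_(size s))%card.
Proof.
move=> us; apply/card_set_bijP; exists (index^~ s); split.
- by move=> x /=; rewrite index_mem.
- move=> x y; rewrite !inE /= => xs ys /(congr1 (nth x s)).
  by rewrite !nth_index.
- move=> k /= ks; case: s us ks => // x s us ks.
  exists (nth x (x :: s) k); first exact: (mem_nth x ks).
  exact: (index_uniq x ks us).
Qed.

Lemma is_nth_smallestE (p : set nat) Q i a : (forall x, p x <-> Q x) ->
  is_nth_smallest p i a <-> Q a /\ i = count_below Q a.
Proof.
move=> pQ; have E : ([set b | p b /\ b < a] #= `I_(count_below Q a))%card.
  rewrite /count_below -size_filter; apply: card_eq_trans (card_set_seq _).
    have -> : [set b | p b /\ b < a] = [set` [seq x <- iota 0 a | Q x]].
      apply/seteqP; split => x /=; rewrite mem_filter mem_iota add0n /=.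
        by move=> [/pQ-> ->].
      by move=> /andP[/pQ].
    exact: card_eqxx.
  by rewrite filter_uniq ?iota_uniq.
split=> [[pa ca]|[Qa ->]]; last by split; [apply/pQ | exact: E].
split; first exact/pQ.
by apply/card_eq_II; apply: card_eq_trans E; apply: card_esym.
Qed.

Lemma PsetE m (p : set nat) Q x : (forall x, p x <-> Q x) ->
  Pset m p x <-> exists2 a, Q a & x = spread m Q a.
Proof.
move=> pQ; split=> [[i [a [/(is_nth_smallestE _ _ pQ)[Qa ->] ->]]]|[a Qa ->]].
  by exists a.
exists (count_below Q a), a; split=> //; exact/(is_nth_smallestE _ _ pQ).
Qed.

Definition spread_seq m Q N := [seq spread m Q a | a <- iota 0 N & Q a].

Lemma spread_seq_uniq m Q N : uniq (spread_seq m Q N).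
Proof.
rewrite map_inj_in_uniq ?filter_uniq ?iota_uniq // => a b.
rewrite !mem_filter => /andP[Qa _] /andP[Qb _].
case: (ltngtP a b) => // h E.
  by have := spread_ltn m Qa h; rewrite E ltnn.
by have := spread_ltn m Qb h; rewrite E ltnn.
Qed.
End Counting.

Lemma sum_spread_seq (R : realType) m Q N (F : nat -> R) :
  \sum_(x <- spread_seq m Q N) F x =
  \sum_(k < count_below Q N) F (m * (enum_below Q N k - k) + k)%N.
Proof.
rewrite big_map (big_nth 0%N) size_filter big_mkord; apply: eq_bigr => k _.
by rewrite -/(enum_below Q N k) /spread count_enum_below ?ltn_ord.
Qed.

Lemma sum_enum_below (R : realType) Q N (F : nat -> R) :
  \sum_(k < count_below Q N) F (enum_below Q N k) = \sum_(0 <= x < N | Q x) F x.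
Proof.
by rewrite -[RHS]big_filter /index_iota subn0 (big_nth 0%N) size_filter big_mkord.
Qed.

Section Complement.
Variables (p1 p2 : set nat) (P : pred nat) (m N : nat).
Hypotheses (p1P : forall x, p1 x <-> P x) (p2P : forall x, p2 x <-> predC P x).
Hypotheses (Plt : forall x, P x -> (x < N)%N).
Local Open Scope nat_scope.

Let q := count_below (predC P) N.
Let n := m * count_below P N + q.

Lemma Pset_finiteE : Pset m p1 = [set` spread_seq m P N].
Proof.
apply/seteqP; split=> x.
  move=> /(PsetE _ _ p1P)[a Pa ->] /=; apply: map_f.
  by rewrite mem_filter Pa mem_iota add0n Plt.
move=> /= /mapP[a]; rewrite mem_filter => /andP[Pa _] ->.
by apply/(PsetE _ _ p1P); exists a.
Qed.

Lemma spread_seqC_lt x : x \in spread_seq m (predC P) N -> x < n.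
Proof.
move=> /mapP[a]; rewrite mem_filter mem_iota add0n => /andP[Pa /= aN] ->.
rewrite spreadE /n /q -addnS leq_add ?count_below_ltn //.
by rewrite count_belowCC leq_mul2l count_below_leq ?orbT // ltnW.
Qed.

(** From [N] on every number is in [p2] and has [count_below P N] predecessors
    outside [p2], so that [spread] acts there as a translation and fills up
    everything from [n] on, while the elements below [N] are sent below [n]. *)
Lemma Pset_cofiniteE :
  ~` Pset m p2 = [set` [seq x <- iota 0 n | x \notin spread_seq m (predC P) N]].
Proof.
apply/seteqP; split=> x /=; rewrite mem_filter mem_iota add0n /=.
  move=> nx; apply/andP; split.
    apply/negP => /mapP[a]; rewrite mem_filter => /andP[Pa _] xE.
    by apply: nx; apply/(PsetE _ _ p2P); exists a.
  rewrite ltnNge; apply/negP => xn; apply: nx; apply/(PsetE _ _ p2P).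
  have NE := count_belowC P N.
  pose a := x - m * count_below P N + count_below P N.
  have Na : N <= a by rewrite /a; move: xn; rewrite /n /q; lia.
  exists a; first by apply/negP => /Plt; lia.
  rewrite spreadE count_belowCC (count_below_bounded Plt) //.
  have := count_belowC P a; rewrite (count_below_bounded Plt) // /a.
  move: xn; rewrite /n /q; lia.
move=> /andP[xt xn] /(PsetE _ _ p2P)[a Pa xE].
case: (ltnP a N) => aN.
  by case/negP: xt; rewrite xE map_f // mem_filter Pa mem_iota add0n.
move: xn; rewrite xE spreadE count_belowCC (count_below_bounded Plt) // /n ltn_add2l.
by rewrite ltnNge count_below_leq.
Qed.
End Complement.

Unset Implicit Arguments.

Theorem corollary5p5 (R : realType) (K : scalars) (p1 p2 : set nat) (r : nat)
    (hcover : p1 `|` p2 = [set: nat]) (hdisj : p1 `&` p2 = set0)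
    (hcard : (p1 #= `I_r)%card)
    (gamma theta : nat -> R)
    (hgamma : Dinfty R gamma) (htheta : Dinfty R theta)
    (m : nat) (hm : (0 < m)%N)
    (hfeas : feasible K m gamma theta) :
  \sum_(i \in Pset m p1) gamma i ^+ 2
    <= \sum_(i \in ~` Pset m p2) theta i ^+ 2.
Proof.
pose P x := `[< p1 x >].
have p1P x : p1 x <-> P x by rewrite /P asboolE.
have p2P x : p2 x <-> predC P x.
  have /seteqP[_ /(_ x I) cov] := hcover; have /seteqP[dis _] := hdisj.
  split => [p2x|/= /negP nPx]; first by apply/negP => /p1P p1x; apply: (dis x).
  by case: cov => // /p1P.
have [L LP] : exists L, forall x, P x -> (x < L)%N.
  have /finite_seqP[s sE] : finite_set p1 by exists r.
  exists (\max_(x <- s) x).+1 => x /p1P; rewrite sE /= => xs.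
  by rewrite ltnS leq_bigmax_seq.
have [n0 hn0] := feasible_sums hm hfeas.
(* Large enough for [n] below to exceed both the sizes of the slices and all
   elements of [Pset m p1]. *)
pose N := (L + (n0 + m * L + L))%N.
have NP x : P x -> (x < N)%N by move=> /LP xL; apply: leq_trans xL (leq_addr _ _).
set c := count_below P N; set q := count_below (predC P) N.
have cq : (c + q = N)%N := count_belowC P N.
have cL : (c <= L)%N.
  by rewrite -(count_belowC P L) /c (count_below_bounded LP) ?leq_addr.
pose n := (m * c + q)%N.
have cn : (c <= m * c)%N by rewrite leq_pmull.
have [|nu [nu0 nuT nuS]] := hn0 n; first by rewrite /n; lia.
have incr Q k : (k.+1 < count_below Q N)%N ->
  (enum_below Q N k < enum_below Q N k.+1)%N by apply: enum_below_ltn.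
have hG : \sum_(i \in Pset m p1) gamma i ^+ 2 <= \sum_(0 <= x < N | P x) nu x.
  rewrite (Pset_finiteE _ p1P NP) -fsbig_seq ?spread_seq_uniq // sum_spread_seq.
  rewrite -sum_enum_below; apply: nuS; [by left | exact: incr |].
  move=> k kc; have [Pk _] := enum_below_mem kc; have := LP _ Pk.
  have : (m * (enum_below P N k - k) <= m * L)%N.
    by rewrite leq_mul2l; have := LP _ Pk; lia.
  rewrite /n; lia.
have hT : \sum_(x <- spread_seq m (predC P) N) theta x ^+ 2 <=
    \sum_(0 <= x < N | predC P x) nu x.
  rewrite sum_spread_seq -sum_enum_below; apply: nuS; [by right | exact: incr |].
  move=> k kq; apply: (spread_seqC_lt (N := N)).
  have [Pk kN] := enum_below_mem kq.
  rewrite -{2 3}(count_enum_below kq) -/(spread _ _ _) map_f //.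
  by rewrite mem_filter Pk mem_iota add0n.
have hS : \sum_(0 <= x < N | P x) nu x + \sum_(0 <= x < N | predC P x) nu x <=
    \sum_(k < n) theta k ^+ 2.
  rewrite -nuT -(big_mkord xpredT nu).
  have Nn : (N <= n)%N by rewrite /n; lia.
  rewrite [leRHS](big_cat_nat _ (n := N)) //=.
  by rewrite [X in _ <= X + _](bigID P) /= lerDl sumr_ge0.
have hC : \sum_(k < n) theta k ^+ 2 =
    \sum_(x <- spread_seq m (predC P) N) theta x ^+ 2 +
    \sum_(i \in ~` Pset m p2) theta i ^+ 2.
  rewrite (Pset_cofiniteE _ p2P NP) -fsbig_seq ?filter_uniq ?iota_uniq //.
  rewrite -(big_mkord xpredT (fun k => theta k ^+ 2)) /index_iota subn0.
  rewrite (bigID (fun x => x \in spread_seq m (predC P) N)) /= big_filter.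
  congr (_ + _); rewrite -big_filter; apply: perm_big; apply: uniq_perm.
  - by rewrite filter_uniq ?iota_uniq.
  - exact: spread_seq_uniq.
  - move=> x; rewrite mem_filter mem_iota add0n /=; apply/andb_idr.
    exact: spread_seqC_lt.
by move: hG hT hS; rewrite hC; lra.
Qed.
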